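(* The calculus $\mathsf{G4iSL}'_\Box$ admits the rules Contraction and Cut. That is: if $\Gamma,\varphi,\varphi\Rightarrow\Delta$ is derivable in $\mathsf{G4iSL}'_\Box$, then so is $\Gamma,\varphi\Rightarrow\Delta$; and if $\Gamma_1\Rightarrow\varphi$ and $\varphi,\Gamma_2\Rightarrow\Delta$ are derivable in $\mathsf{G4iSL}'_\Box$, then so is $\Gamma_1,\Gamma_2\Rightarrow\Delta$.
   Context: Formulas are built from the constant $\bot$, atoms (propositional variables) $p,q,r,\dots$, binary connectives $\wedge,\vee,\to$ and the unary modal operator $\Box$ (there is no $\Diamond$); $\neg\varphi$ abbreviates $\varphi\to\bot$; $\bot$ is not an atom. A sequent is an expression $\Gamma\Rightarrow\Delta$ with $\Gamma,\Delta$ finite multisets of formulas, $\Delta$ containing at most one formula. $\Gamma,\Pi$ denotes multiset union. $\Box\Gamma$ is the multiset $\{\Box\varphi\mid\varphi\in\Gamma\}$ and $\boxdot\Gamma=\Gamma\cup\Box\Gamma$ (multiset union). A formula is boxed if it has the form $\Box\psi$. The calculus $\mathsf{G4iSL}'_\Box$ has the following axioms and rules (''from premises infer conclusion''): At: $\Gamma,p\Rightarrow p$ ($p$ an atom). $L\bot$: $\Gamma,\bot\Rightarrow\Delta$. $R\wedge$: from $\Gamma\Rightarrow\varphi$ and $\Gamma\Rightarrow\psi$ infer $\Gamma\Rightarrow\varphi\wedge\psi$. $L\wedge$: from $\Gamma,\varphi,\psi\Rightarrow\Delta$ infer $\Gamma,\varphi\wedge\psi\Rightarrow\Delta$. $R\vee$: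 from $\Gamma\Rightarrow\varphi_i$ ($i=0$ or $1$) infer $\Gamma\Rightarrow\varphi_0\vee\varphi_1$. $L\vee$: from $\Gamma,\varphi\Rightarrow\Delta$ and $\Gamma,\psi\Rightarrow\Delta$ infer $\Gamma,\varphi\vee\psi\Rightarrow\Delta$. $R{\to}$: from $\Gamma,\varphi\Rightarrow\psi$ infer $\Gamma\Rightarrow\varphi\to\psi$. $Lp{\to}$: from $\Gamma,p,\varphi\Rightarrow\Delta$ infer $\Gamma,p,p\to\varphi\Rightarrow\Delta$ ($p$ an atom). $L{\wedge}{\to}$: from $\Gamma,\varphi\to(\psi\to\gamma)\Rightarrow\Delta$ infer $\Gamma,\varphi\wedge\psi\to\gamma\Rightarrow\Delta$. $L{\vee}{\to}$: from $\Gamma,\varphi\to\gamma,\psi\to\gamma\Rightarrow\Delta$ infer $\Gamma,\varphi\vee\psi\to\gamma\Rightarrow\Delta$. $L{\to}{\to}'$: from $\Gamma,\psi\to\gamma,\varphi\Rightarrow\psi$ and $\Gamma,\gamma\Rightarrow\Delta$ infer $\Gamma,(\varphi\to\psi)\to\gamma\Rightarrow\Delta$. $\to_{\rm SL}$: from $\Pi,\boxdot\Gamma,\Box\varphi,\Box\varphi\to\psi\Rightarrow\varphi$ and $\Pi,\Box\Gamma,\psi\Rightarrow\Delta$ infer $\Pi,\Box\Gamma,\Box\varphi\to\psi\Rightarrow\Delta$, where $\Pi$ contains no boxed formulas. $\mathcal R^4_{\rm SL}$: from $\Pi,\boxdot\Gamma,\Box\varphi\Rightarrow\varphi$ infer $\Pi,\Box\Gamma\Rightarrow\Box\varphi$,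 where $\Pi$ contains no boxed formulas. *)

(* Defs.v *)
From HB Require Import structures.
From mathcomp Require Import all_boot.
From mathcomp Require Import finmap multiset.

Set Implicit Arguments.
Unset Strict Implicit.
Unset Printing Implicit Defensive.

Local Open Scope mset_scope.

(* Atoms are indexed by [nat]. *)
Inductive form : Type :=
| Bot : form
| Atom : nat -> form
| And : form -> form -> form
| Or : form -> form -> form
| Imp : form -> form -> form
| Box : form -> form.

(* Encoding into generic trees, needed only to make [form] a [choiceType], so
   that [{mset form}] is available. *)
Fixpoint form_encode (A : form) : GenTree.tree nat :=
  match A with
  | Bot => GenTree.Node 0 [::]
  | Atom p => GenTree.Leaf p
  | And A B => GenTree.Node 1 [:: form_encode A; form_encode B]
  | Or A B => GenTree.Node 2 [:: form_encode A; form_encode B]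
  | Imp A B => GenTree.Node 3 [:: form_encode A; form_encode B]
  | Box A => GenTree.Node 4 [:: form_encode A]
  end.

Fixpoint form_decode (t : GenTree.tree nat) : form :=
  match t with
  | GenTree.Leaf p => Atom p
  | GenTree.Node 1 [:: t1; t2] => And (form_decode t1) (form_decode t2)
  | GenTree.Node 2 [:: t1; t2] => Or (form_decode t1) (form_decode t2)
  | GenTree.Node 3 [:: t1; t2] => Imp (form_decode t1) (form_decode t2)
  | GenTree.Node 4 [:: t1] => Box (form_decode t1)
  | _ => Bot
  end.

Lemma form_encodeK : cancel form_encode form_decode.
Proof. by elim=> //= [A -> B ->|A -> B ->|A -> B ->|A ->]. Qed.

HB.instance Definition _ := Countable.copy form (can_type form_encodeK).

Declare Scope form_scope.
Delimit Scope form_scope with form.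
Bind Scope form_scope with form.
Notation "A ∧ B" := (And A B)
  (at level 35, right associativity) : form_scope.
Notation "A ∨ B" := (Or A B)
  (at level 36, right associativity) : form_scope.
Notation "A → B" := (Imp A B)
  (at level 37, right associativity) : form_scope.
Notation "□ A" := (Box A) (at level 30, right associativity) : form_scope.

Definition is_boxed (A : form) : bool := if A is Box _ then true else false.

Definition box_free (P : {mset form}) : Prop :=
  {in P, forall A, ~~ is_boxed A}.

(* Multiplicities are those of the image: [Box A] occurs in [box_mset G] as
   often as [A] occurs in [G]. *)
Definition box_mset (G : {mset form}) : {mset form} :=
  seq_mset [seq Box A | A <- G].

Definition dotbox_mset (G : {mset form}) : {mset form} := G `+` box_mset G.

Notation "G ,, A" := (msetD G (msetn 1 A%form))
  (at level 65, left associativity) : mset_scope.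

Reserved Notation "G ⇒ D" (at level 70, no associativity).

(* [G ⇒ D] is derivability in G4iSL'_Box of a sequent with antecedent [G]; the
   succedent, a multiset with at most one element, is an [option form]. *)
Inductive G4iSL' : {mset form} -> option form -> Prop :=
| At (G : {mset form}) (p : nat) :
    G,, Atom p ⇒ Some (Atom p)
| LBot (G : {mset form}) (D : option form) :
    G,, Bot ⇒ D
| RAnd (G : {mset form}) (A B : form) :
    G ⇒ Some A -> G ⇒ Some B -> G ⇒ Some (A ∧ B)%form
| LAnd (G : {mset form}) (A B : form) (D : option form) :
    G,, A,, B ⇒ D -> G,, A ∧ B ⇒ D
| ROr1 (G : {mset form}) (A B : form) :
    G ⇒ Some A -> G ⇒ Some (A ∨ B)%form
| ROr2 (G : {mset form}) (A B : form) :
    G ⇒ Some B -> G ⇒ Some (A ∨ B)%form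
| LOr (G : {mset form}) (A B : form) (D : option form) :
    G,, A ⇒ D -> G,, B ⇒ D -> G,, A ∨ B ⇒ D
| RImp (G : {mset form}) (A B : form) :
    G,, A ⇒ Some B -> G ⇒ Some (A → B)%form
| LAtomImp (G : {mset form}) (p : nat) (A : form) (D : option form) :
    G,, Atom p,, A ⇒ D -> G,, Atom p,, (Atom p → A) ⇒ D
| LAndImp (G : {mset form}) (A B C : form) (D : option form) :
    G,, (A → (B → C)) ⇒ D -> G,, ((A ∧ B) → C) ⇒ D
| LOrImp (G : {mset form}) (A B C : form) (D : option form) :
    G,, (A → C),, (B → C) ⇒ D -> G,, ((A ∨ B) → C) ⇒ D
| LImpImp (G : {mset form}) (A B C : form) (D : option form) :
    G,, (B → C),, A ⇒ Some B -> G,, C ⇒ D -> G,, ((A → B) → C) ⇒ D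
| ImpSL (P G : {mset form}) (A B : form) (D : option form) :
    box_free P ->
    P `+` dotbox_mset G,, □ A,, (□ A → B) ⇒ Some A ->
    P `+` box_mset G,, B ⇒ D ->
    P `+` box_mset G,, (□ A → B) ⇒ D
| R4SL (P G : {mset form}) (A : form) :
    box_free P ->
    P `+` dotbox_mset G,, □ A ⇒ Some A ->
    P `+` box_mset G ⇒ Some (□ A)%form
where "G ⇒ D" := (G4iSL' G%mset D).

(* Main.v *)
(** Derivability is shown to coincide with validity in finite Kripke models of
    strong Löb logic, where contraction and cut are trivial.  The models are
    trees with an intuitionistic order [le] and a modal relation [modal] that is
    contained in [le], absorbs it on both sides and is well founded.

    For completeness, a sequent is decided by backward proof search.  Invertible
    rules preserve countermodels upwards.  When none applies, the countermodels
    of the refutable premises of the other rules are grafted above a new root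
    forcing exactly the atoms of the antecedent: premises of [ImpSL] and [R4SL]
    along modal edges, the others along intuitionistic ones.  The search
    terminates because the premise of [R4SL] and the left one of [ImpSL] put a new boxed
    subformula into the antecedent, unless the box is already there, in which
    case that premise is an instance of the identity; every other premise
    decreases a Dyckhoff-style weight. *)

Require Import Defs.
From mathcomp Require Import all_boot.
From mathcomp Require Import finmap multiset.
From mathcomp Require Import zify.

Set Implicit Arguments.
Unset Strict Implicit.
Unset Printing Implicit Defensive.

Local Open Scope mset_scope.

(** * Multisets and the splitting of an antecedent into boxed and other formulas *)

Lemma msetD_remove (T : choiceType) (x : T) (G : {mset T}) :
  x \in G -> G `\ x `+` [mset x] = G.
Proof. by move=> xG; rewrite msetDC msetB1K. Qed.

Lemma big_msetD (T : choiceType) (F : T -> nat) (G H : {mset T}) :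
  \sum_(x <- G `+` H) F x = \sum_(x <- G) F x + \sum_(x <- H) F x.
Proof.
rewrite -big_cat /=; apply/perm_big/allP => x _ /=.
by rewrite count_cat !count_mem_mset msetE2.
Qed.

Lemma mem_seq_mset (T : choiceType) (s : seq T) : seq_mset s =i s.
Proof. by move=> x; apply/perm_mem/perm_eq_seq_mset. Qed.

Lemma mem_box_mset (G : {mset form}) (A : form) :
  (Box A \in box_mset G) = (A \in G).
Proof. by rewrite mem_seq_mset mem_map // => ? ? []. Qed.

Definition unbox (A : form) : option form := if A is Box B then Some B else None.

Definition unboxed (G : {mset form}) : {mset form} := seq_mset (pmap unbox G).

Definition nonboxed (G : {mset form}) : {mset form} :=
  seq_mset [seq A <- G | ~~ is_boxed A].

Lemma unboxedE (G : {mset form}) (A : form) : unboxed G A = G (Box A).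
Proof.
have box_eq B : (Box B == Box A) = (B == A).
  by rewrite (inj_eq (f := Box)) // => ? ? [].
rewrite mset_seqE -count_mem_mset.
by elim: (enum_mset G) => // -[] //= B s ->; rewrite box_eq.
Qed.

Lemma mem_unboxed (G : {mset form}) (A : form) :
  (A \in unboxed G) = (Box A \in G).
Proof. by rewrite !in_mset unboxedE. Qed.

Lemma box_free_nonboxed (G : {mset form}) : box_free (nonboxed G).
Proof. by move=> A; rewrite mem_seq_mset mem_filter => /andP[]. Qed.

Lemma box_split (G : {mset form}) :
  nonboxed G `+` box_mset (unboxed G) = G.
Proof.
apply/msetP => A; rewrite msetE2 !mset_seqE -count_mem_mset.
rewrite (permP (perm_map _ (perm_eq_seq_mset _))).
elim: (enum_mset G) => // B s /= <-; case: B => *; rewrite /= ?addnA //.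
lia.
Qed.

(** Instantiates the rule at the canonical splitting of [G], which discharges the side condition;
    the premise keeps [G] and adds the bodies of its boxes. *)
Lemma R4SL_unboxed (G : {mset form}) (A : form) :
  G `+` unboxed G,, □ A ⇒ Some A -> G ⇒ Some (□ A)%form.
Proof.
move=> h; rewrite -(box_split G); apply: R4SL; first exact: box_free_nonboxed.
by rewrite /dotbox_mset msetDCA box_split (msetDC (unboxed G)).
Qed.

Lemma ImpSL_unboxed (G : {mset form}) (A B : form) (D : option form) :
  G `+` unboxed G,, □ A,, (□ A → B) ⇒ Some A -> G,, B ⇒ D ->
  G,, (□ A → B) ⇒ D.
Proof.
move=> h1 h2; rewrite -(box_split G).
apply: ImpSL; first exact: box_free_nonboxed.
  by rewrite /dotbox_mset msetDCA box_split (msetDC (unboxed G)).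
by rewrite box_split.
Qed.

(** * Identity for arbitrary formulas *)

Ltac mset_ac := by apply/msetP => ?; rewrite !msetE2; lia.

(** Proved together because identity for an implication uses modus ponens on its antecedent. The
    extra context [H] absorbs what the left rules leave of [A] and so stands in for weakening. *)
Lemma identity_modus_ponens (A : form) :
  (forall G : {mset form}, G,, A ⇒ Some A) /\
  (forall (G : {mset form}) (B : form) (D : option form),
     (forall H, G `+` H,, B ⇒ D) -> G,, A,, (A → B) ⇒ D).
Proof.
elim: A => [|p|A [idA mpA] C [idC mpC]|A [idA mpA] C [idC mpC]
           |A [idA mpA] C [idC mpC]|A [idA mpA]];
  try have idA' G : A \in G -> G ⇒ Some A by move/msetD_remove <-.
all: split => [G|G B D h].
- exact: LBot.
- by rewrite msetDAC; apply: LBot.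
- exact: At.
- exact/LAtomImp/h.
- apply: LAnd; apply: RAnd; last exact: idC.
  by rewrite msetDAC; apply: idA.
- apply: LAndImp; rewrite msetDAC; apply: LAnd.
  have -> : G,, (A → (C → B)),, A,, C = G,, C,, A,, (A → (C → B)) by mset_ac.
  apply: mpA => H; rewrite (msetDAC _ _ H); apply: mpC => K.
  by rewrite -(msetDA _ _ K); apply: h.
- by apply: LOr; [apply/ROr1/idA | apply/ROr2/idC].
- apply: LOrImp.
  have -> : G,, (A ∨ C),, (A → B),, (C → B)
          = G,, (A → B),, (C → B),, (A ∨ C) by mset_ac.
  apply: LOr.
    have -> : G,, (A → B),, (C → B),, A = G,, (C → B),, A,, (A → B) by mset_ac.
    by apply: mpA => H; rewrite -(msetDA _ _ H); apply: h.
  have -> : G,, (A → B),, (C → B),, C = G,, (A → B),, C,, (C → B) by mset_ac.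
  by apply: mpC => H; rewrite -(msetDA _ _ H); apply: h.
- apply: RImp; rewrite msetDAC; apply: mpA => H; exact: idC.
- apply: LImpImp; last exact: h.
  have -> : G,, (A → C),, (C → B),, A = G,, (C → B),, A,, (A → C) by mset_ac.
  by apply: mpA => H; apply: idC.
- by apply/R4SL_unboxed/idA'; rewrite !in_msetE mem_unboxed !in_msetE eqxx !orbT.
- apply: ImpSL_unboxed; last exact: h.
  by apply: idA'; rewrite !in_msetE mem_unboxed !in_msetE eqxx !orbT.
Qed.

Lemma identity (G : {mset form}) (A : form) : A \in G -> G ⇒ Some A.
Proof. by move/msetD_remove <-; case: (identity_modus_ponens A). Qed.

(** * Finite Kripke models of strong Löb logic *)

(* [Child b c t] is [t] with the tree [c] added above its root, as a modal
   successor when [b] is true. *)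
Inductive tree : Type :=
| Root : pred nat -> tree
| Child : bool -> tree -> tree -> tree.

Fixpoint val_root (t : tree) : pred nat :=
  match t with Root V => V | Child _ _ t => val_root t end.

(** A point is identified with the tree rooted at it. In [Child b c t] the tree [t] stands for the
    rest of the same root, so only the points above it count. *)
Fixpoint above (t s : tree) : Prop :=
  match t with
  | Root _ => False
  | Child _ c t => [\/ s = c, above c s | above t s]
  end.

(** The first disjunct makes [modal] absorb [above] on the right, the second on the left. *)
Fixpoint modal (t s : tree) : Prop :=
  match t with
  | Root _ => False
  | Child b c t => [\/ b /\ (s = c \/ above c s), modal c s | modal t s]
  end.

Lemma modal_above (t s : tree) : modal t s -> above t s.
Proof.
elim: t => //= b c IHc t IHt [[_ [|]]|/IHc|/IHt];
  by [constructor 1|constructor 2|constructor 3].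
Qed.

Lemma above_trans (t u s : tree) : above t u -> above u s -> above t s.
Proof.
elim: t => //= b c IHc t IHt [->|/IHc h|/IHt h] us; first by constructor 2.
  by constructor 2; apply: h.
by constructor 3; apply: h.
Qed.

Lemma above_modal (t u s : tree) : above t u -> modal u s -> modal t s.
Proof.
elim: t => //= b c IHc t IHt [->|/IHc h|/IHt h] us; first by constructor 2.
  by constructor 2; apply: h.
by constructor 3; apply: h.
Qed.

Lemma modal_above_trans (t u s : tree) : modal t u -> above u s -> modal t s.
Proof.
elim: t => //= b c IHc t IHt [[tb [->|cu]]|/IHc h|/IHt h] us.
- by constructor 1; split=> //; right.
- by constructor 1; split=> //; right; apply: above_trans cu us.
- by constructor 2; apply: h.
- by constructor 3; apply: h.
Qed.

Lemma modal_trans (t u s : tree) : modal t u -> modal u s -> modal t s.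
Proof. by move=> tu /modal_above; apply: modal_above_trans. Qed.

(** Modal steps go strictly up in a finite tree. The induction runs over the points strictly above a
    root, which is all that [t] contributes to [Child b c t]. *)
Lemma modal_wf (t : tree) : Acc (fun s t => modal t s) t.
Proof.
suff h : forall s, above t s -> Acc (fun s t => modal t s) s.
  by constructor=> s /modal_above/h.
elim: t => [V|b c IHc t IHt] s; first by [].
case=> [->|/IHc|/IHt]; [|exact|exact].
by constructor=> u /modal_above/IHc.
Qed.

Definition le (t s : tree) : Prop := s = t \/ above t s.

Lemma le_trans (t u s : tree) : le t u -> le u s -> le t s.
Proof. by case=> [->|tu] // [->|us]; right=> //; apply: above_trans tu us. Qed.

Lemma le_modal (t u s : tree) : le t u -> modal u s -> modal t s.
Proof. by case=> [->|tu] //; apply: above_modal. Qed.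

(* Quantifying over [le] in the atomic case makes forcing persistent without a
   monotonicity condition on valuations. *)
Fixpoint force (t : tree) (A : form) : Prop :=
  match A with
  | Bot => False
  | Atom p => forall s, le t s -> val_root s p
  | And A B => force t A /\ force t B
  | Or A B => force t A \/ force t B
  | Imp A B => forall s, le t s -> force s A -> force s B
  | Box A => forall s, modal t s -> force s A
  end.

Lemma force_le (t s : tree) (A : form) : le t s -> force t A -> force s A.
Proof.
move=> ts; elim: A => //=
  [p h u su|A IHA B IHB []|A IHA B IHB []|A _ B _ h u su|A _ h u su].
- exact/h/le_trans/su.
- by split; [apply: IHA | apply: IHB].
- by left; apply: IHA.
- by right; apply: IHB.
- exact/h/le_trans/su.
- exact/h/le_modal/su.
Qed.

(** * Validity and soundness *)

Definition forces (t : tree) (G : {mset form}) : Prop :=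
  forall A, A \in G -> force t A.

Definition force_opt (t : tree) (D : option form) : Prop :=
  if D is Some A then force t A else False.

Lemma forces_le (t s : tree) (G : {mset form}) : le t s -> forces t G -> forces s G.
Proof. by move=> ts tG A /tG; apply: force_le. Qed.

Lemma forces_add (t : tree) (G : {mset form}) (A : form) :
  forces t (G,, A) <-> forces t G /\ force t A.
Proof.
split=> [h|[tG tA] B].
  by split=> [B BG|]; apply: h; rewrite in_msetD ?BG // in_msetn eqxx orbT.
by rewrite in_msetD in_msetn => /orP[/tG|/andP[_ /eqP ->]].
Qed.

Lemma forces_modal (t s : tree) (P G : {mset form}) :
  modal t s -> forces t (P `+` box_mset G) -> forces s (P `+` dotbox_mset G).
Proof.
move=> ts tPG; have sPG := forces_le (or_intror (modal_above ts)) tPG.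
move=> A; rewrite in_msetD => /orP[AP|]; first by apply: sPG; rewrite in_msetD AP.
rewrite in_msetD => /orP[AG|AG]; last by apply: sPG; rewrite in_msetD AG orbT.
by apply: (tPG (Box A)) => //; rewrite in_msetD mem_box_mset AG orbT.
Qed.

(** Well-founded induction along [modal]: by transitivity the modal successors of [s] are modal
    successors of [t], so the induction hypothesis gives [□ A] at [s]. *)
Lemma force_loeb (t : tree) (A : form) :
  (forall s, modal t s -> force s (Box A) -> force s A) -> force t (Box A).
Proof.
move=> h s; elim: (modal_wf s) => {}s _ IH ts; apply: h => // u su.
by apply: IH => //; apply: modal_trans ts su.
Qed.

Theorem soundness (G : {mset form}) (D : option form) :
  G ⇒ D -> forall t, forces t G -> force_opt t D.
Proof.
elim=> {G D}.
- by move=> G p t /forces_add[].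
- by move=> G D t /forces_add[_ []].
- by move=> G A B _ IHA _ IHB t tG; split; [apply: IHA | apply: IHB].
- by move=> G A B D _ IH t /forces_add[tG [tA tB]]; apply: IH; rewrite !forces_add.
- by move=> G A B _ IH t tG; left; apply: IH.
- by move=> G A B _ IH t tG; right; apply: IH.
- move=> G A B D _ IHA _ IHB t /forces_add[tG [tA|tB]].
    by apply: IHA; rewrite forces_add.
  by apply: IHB; rewrite forces_add.
- move=> G A B _ IH t tG s ts sA; apply: IH.
  by rewrite forces_add; split=> //; apply: forces_le tG.
- move=> G p A D _ IH t /forces_add[/forces_add[tG tp] tpA].
  by apply: IH; rewrite !forces_add; split=> //; apply: tpA => //; left.
- move=> G A B C D _ IH t /forces_add[tG tABC].
  apply: IH; rewrite forces_add; split=> // s ts sA u su uB.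
  by apply: tABC; [apply: le_trans su | split=> //; apply: force_le sA].
- move=> G A B C D _ IH t /forces_add[tG tABC].
  apply: IH; rewrite !forces_add; split; first split=> // s ts sA.
    by apply: (tABC s ts); left.
  by move=> s ts sB; apply: (tABC s ts); right.
- move=> G A B C D _ IH1 _ IH2 t /forces_add[tG tABC].
  apply: IH2; rewrite forces_add; split=> //; apply: (tABC); first by left.
  (* Wherever [B] holds, so does [A → B], hence [C]; this supplies the assumption [B → C] of the
     left premise. *)
  move=> s ts sA; apply: IH1; rewrite !forces_add; split=> //.
  split; first exact: forces_le tG.
  move=> u su uB; apply: tABC; first exact: le_trans su.
  by move=> v uv _; apply: force_le uB.
- move=> P G A B D _ _ IH1 _ IH2 t /forces_add[tG tAB].
  apply: IH2; rewrite forces_add; split=> //; apply: (tAB); first by left.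
  apply: force_loeb => s ts sA; apply: IH1; rewrite !forces_add; split.
    by split=> //; apply: forces_modal tG.
  by apply: force_le tAB; right; apply: modal_above.
- move=> P G A _ _ IH t tG; apply: force_loeb => s ts sA.
  by apply: IH; rewrite forces_add; split=> //; apply: forces_modal tG.
Qed.

(** * Sequents with a derivation or a countermodel *)

Definition countermodel (t : tree) (G : {mset form}) (D : option form) : Prop :=
  forces t G /\ ~ force_opt t D.

Definition decided (G : {mset form}) (D : option form) : Prop :=
  G ⇒ D \/ exists t, countermodel t G D.

(** Pattern for an invertible rule: invertibility appears as the transfer of countermodels from
    premise to conclusion. *)
Lemma decided_map (G G' : {mset form}) (D D' : option form) :
  decided G' D' -> (G' ⇒ D' -> G ⇒ D) ->
  (forall t, countermodel t G' D' -> countermodel t G D) -> decided G D.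
Proof. by move=> [d'|[t t']] hd ht; [left; apply: hd | right; exists t; apply: ht]. Qed.

Lemma decided_map2 (G G1 G2 : {mset form}) (D D1 D2 : option form) :
  decided G1 D1 -> decided G2 D2 -> (G1 ⇒ D1 -> G2 ⇒ D2 -> G ⇒ D) ->
  (forall t, countermodel t G1 D1 -> countermodel t G D) ->
  (forall t, countermodel t G2 D2 -> countermodel t G D) -> decided G D.
Proof.
move=> [d1|[t t1]] d2 hd h1 h2; last by right; exists t; apply: h1.
by apply: decided_map d2 _ h2; apply: hd.
Qed.

(** * The termination measure *)

(* Conjunctions count for two so that [A → (B → C)] is smaller than
   [(A ∧ B) → C]. *)
Fixpoint size_form (A : form) : nat :=
  match A with
  | Bot | Atom _ => 1
  | And A B => (size_form A + size_form B).+2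
  | Or A B | Imp A B => (size_form A + size_form B).+1
  | Box A => (size_form A).+1
  end.

Lemma size_form_gt0 (A : form) : 0 < size_form A. Proof. by case: A. Qed.

(* Base 4: a rule trades one formula for at most three smaller ones, counting
   the succedent. *)
Definition weight (A : form) : nat := 4 ^ size_form A.

Definition weight_seq (s : seq form) : nat := \sum_(A <- s) weight A.

Definition weight_sequent (G : {mset form}) (D : option form) : nat :=
  weight_seq G + weight_seq (seq_of_opt D).

Lemma weight_lt (s : seq form) (A : form) :
  size s < 4 -> {in s, forall B, size_form B < size_form A} ->
  weight_seq s < weight A.
Proof.
move=> s4 h; have [n An] : exists n, size_form A = n.+1.
  by exists (size_form A).-1; rewrite prednK ?size_form_gt0.
apply: (@leq_ltn_trans (size s * 4 ^ n)); last first.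
  by rewrite /weight An expnS ltn_mul2r expn_gt0.
rewrite /weight_seq -sum1_size big_distrl /= big_seq_cond [leqRHS]big_seq_cond.
apply: leq_sum => B; rewrite andbT => /h; rewrite An ltnS mul1n => Bn.
by rewrite leq_pexp2l.
Qed.

Lemma weight_add (G : {mset form}) (A : form) :
  weight_seq (G,, A) = weight_seq G + weight A.
Proof. by rewrite /weight_seq big_msetD enum_msetn big_seq1. Qed.

Lemma weight_cons (A : form) (s : seq form) :
  weight_seq (A :: s) = weight A + weight_seq s.
Proof. by rewrite /weight_seq big_cons. Qed.

(** Every box met in a search has its body in this list for some formula of the root sequent; [U]
    will collect these bodies. *)
Fixpoint box_bodies (A : form) : seq form :=
  match A with
  | Bot | Atom _ => [::]
  | And A B | Or A B | Imp A B => box_bodies A ++ box_bodies B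
  | Box A => A :: box_bodies A
  end.

Section Completeness.

Variable U : seq form.

Definition within (G : {mset form}) (D : option form) : Prop :=
  forall A, A \in G \/ D = Some A -> {subset box_bodies A <= U}.

Definition missing (G : {mset form}) : nat := count (fun A => Box A \notin G) U.

(** Lexicographic: a modal premise may increase the weight, but then [missing] drops. Being [within]
    [U] is carried along because [missing] counts only over [U]. *)
Definition lower (S' S : {mset form} * option form) : Prop :=
  within S'.1 S'.2 /\
  (missing S'.1 < missing S.1 \/
   missing S'.1 <= missing S.1 /\
   weight_sequent S'.1 S'.2 < weight_sequent S.1 S.2).

Definition add_seq (G : {mset form}) (s : seq form) : {mset form} :=
  foldl (fun G A => G,, A) G s.

Lemma mem_add_seq (G : {mset form}) (s : seq form) (A : form) :
  (A \in add_seq G s) = (A \in G) || (A \in s).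
Proof.
elim: s G => [|B s IH] G /=; first by rewrite orbF.
by rewrite IH inE in_msetD in_msetn /= orbA.
Qed.

Lemma weight_add_seq (G : {mset form}) (s : seq form) :
  weight_seq (add_seq G s) = weight_seq G + weight_seq s.
Proof.
elim: s G => [|B s IH] G /=; first by rewrite /weight_seq big_nil addn0.
by rewrite IH weight_add weight_cons addnA.
Qed.

Lemma missing_le (G G' : {mset form}) :
  (forall A, Box A \in G -> Box A \in G') -> missing G' <= missing G.
Proof. by move=> GG'; apply: sub_count => A; apply/contra/GG'. Qed.

Lemma missing_lt (G G' : {mset form}) (A : form) :
  (forall A, Box A \in G -> Box A \in G') -> A \in U -> Box A \notin G ->
  Box A \in G' -> missing G' < missing G.
Proof.
rewrite /missing => GG'; elim: U => //= B s IH; rewrite inE => AU AG AG'.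
have h : count (fun A => Box A \notin G') s <= count (fun A => Box A \notin G) s.
  by apply: sub_count => C; apply/contra/GG'.
have [eAB|neAB] := eqVneq A B.
  by rewrite -eAB AG AG'.
move: AU; rewrite (negPf neAB) => /= /IH /(_ AG AG').
have : (Box B \notin G') <= (Box B \notin G).
  by case BG: (Box B \in G) => //=; rewrite ?(GG' _ BG) //; case: (_ \in _).
by move=> hB hs; rewrite -addnS leq_add.
Qed.

(** As [F] is not boxed, deleting it cannot raise [missing]. The succedent may change, as in the
    left premise of [LImpImp]. *)
Lemma lower_left (G : {mset form}) (F : form) (s : seq form) (D D' : option form) :
  ~~ is_boxed F -> within (G,, F) D ->
  (forall A, A \in s \/ D' = Some A ->
     {subset box_bodies A <= box_bodies F ++ oapp box_bodies [::] D}) ->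
  weight_seq s + weight_seq (seq_of_opt D') < weight F + weight_seq (seq_of_opt D) ->
  lower (add_seq G s, D') (G,, F, D).
Proof.
move=> nF inU sU w; split=> [A|]; last right; last split=> /=.
- rewrite /= mem_add_seq => AG B.
  have [AF|[AG1|AG1]] : A \in G \/ (A \in s \/ D' = Some A).
    + by case: AG => [/orP[]|]; tauto.
    + by apply: (inU A); left; rewrite in_msetD AF.
  + move=> /(sU A (or_introl AG1)); rewrite mem_cat => /orP[BF|].
      by apply: (inU F) BF; left; rewrite in_msetD in_msetn eqxx orbT.
    case: D inU {sU w} => //= E inU; apply: (inU E); by right.
  + move=> /(sU A (or_intror AG1)); rewrite mem_cat => /orP[BF|].
      by apply: (inU F) BF; left; rewrite in_msetD in_msetn eqxx orbT.
    case: D inU {sU w} => //= E inU; apply: (inU E); by right.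
- apply: missing_le => A; rewrite mem_add_seq in_msetD in_msetn /=.
  by case/orP=> [->|/eqP eF] //; rewrite -eF in nF.
- by rewrite /weight_sequent weight_add_seq weight_add -!addnA ltn_add2l.
Qed.

Lemma lower_right (G : {mset form}) (s : seq form) (A A' : form) :
  within G (Some A) ->
  (forall B, B \in A' :: s -> {subset box_bodies B <= box_bodies A}) ->
  weight_seq (A' :: s) < weight A ->
  lower (add_seq G s, Some A') (G, Some A).
Proof.
move=> inU sU w; split=> [B|]; last right; last split=> /=.
- rewrite /= mem_add_seq => BG C.
  have [BF|Bs] : B \in G \/ B \in A' :: s.
    rewrite inE; case: BG => [/orP[BG|Bs]|[->]]; first by left.
      by right; rewrite Bs orbT.
    by right; rewrite eqxx.
  + by apply: (inU B); left.
  + by move=> /(sU B Bs); apply: (inU A); right.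
- by apply: missing_le => B; rewrite mem_add_seq => ->.
- rewrite /weight_sequent weight_add_seq -addnA ltn_add2l /=.
  by move: w; rewrite !weight_cons (addnC (weight A')) addnA /weight_seq big_nil !addn0.
Qed.

Lemma lower_unboxed (G : {mset form}) (A : form) (D : option form) :
  within G D -> A \in U -> {subset box_bodies A <= U} -> Box A \notin G ->
  lower (G `+` unboxed G,, □ A, Some A) (G, D).
Proof.
move=> inU AU bAU AG; split=> /= [B|]; last left.
  case=> [|[<-]] //; rewrite !in_msetD mem_unboxed in_msetn /=.
  case/orP=> [/orP[BG|BG]|/eqP ->].
  - by apply: inU; left.
  - by move=> C CB; apply: (inU (Box B)); [left | rewrite inE CB orbT].
  - by move=> C; rewrite inE => /orP[/eqP ->|/bAU].
apply: (missing_lt (A := A)) => // [B BG|];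
  by rewrite !in_msetD ?BG // in_msetn eqxx !orbT.
Qed.

(** * One step of the search *)

Section Step.

Variables (G : {mset form}) (D : option form).
Hypothesis inU : within G D.
Hypothesis decided_lower : forall S, lower S (G, D) -> decided S.1 S.2.

Lemma decided_left (F : form) (s : seq form) (D' : option form) :
  F \in G -> ~~ is_boxed F ->
  (forall A, A \in s \/ D' = Some A ->
     {subset box_bodies A <= box_bodies F ++ oapp box_bodies [::] D}) ->
  weight_seq s + weight_seq (seq_of_opt D') < weight F + weight_seq (seq_of_opt D) ->
  decided (add_seq (G `\ F) s) D'.
Proof.
move=> FG nF sU w; apply: (decided_lower (S := (_, _))).
by rewrite -{2}(msetD_remove FG); apply: lower_left => //; rewrite msetD_remove.
Qed.

Lemma decided_left1 (F A : form) :
  F \in G -> ~~ is_boxed F -> {subset box_bodies A <= box_bodies F} ->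
  size_form A < size_form F -> decided (G `\ F,, A) D.
Proof.
move=> FG nF sU w; apply: (decided_left (s := [:: A])) => //.
  move=> B [|->] => [|C CB]; last by rewrite mem_cat /= CB orbT.
  by rewrite inE => /eqP -> C /sU CF; rewrite mem_cat CF.
by rewrite ltn_add2r; apply: weight_lt => // B; rewrite inE => /eqP ->.
Qed.

Lemma decided_left2 (F A B : form) :
  F \in G -> ~~ is_boxed F ->
  {subset box_bodies A <= box_bodies F} -> {subset box_bodies B <= box_bodies F} ->
  size_form A < size_form F -> size_form B < size_form F ->
  decided (G `\ F,, A,, B) D.
Proof.
move=> FG nF sA sB wA wB; apply: (decided_left (s := [:: A; B])) => //.
  move=> E [|->] => [|C CE]; last by rewrite mem_cat /= CE orbT.
  by rewrite !inE => /orP[] /eqP -> C => [/sA|/sB] CF; rewrite mem_cat CF.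
rewrite ltn_add2r; apply: weight_lt => // E.
by rewrite !inE => /orP[] /eqP ->.
Qed.

(** * Grafting countermodels above a root *)

Definition extends (t t' : tree) : Prop :=
  (forall s, above t s -> above t' s) /\ (forall s, modal t s -> modal t' s).

(* The root of [t] may be extended to a countermodel by grafting more trees. *)
Definition partial_root (t : tree) : Prop :=
  [/\ forall p, val_root t p = (Atom p \in G),
      forall s, above t s -> forces s G &
      forall s, modal t s -> forces s (unboxed G)].

(** A requirement that can be met from any stage of the construction of the root, so that
    requirements can be treated one at a time. *)
Definition attainable (Q : tree -> Prop) : Prop :=
  forall t, partial_root t -> exists t', [/\ partial_root t', extends t t' & Q t'].

Definition monotone (Q : tree -> Prop) : Prop :=
  forall t t', extends t t' -> Q t -> Q t'.

(** Meet [Q] first, then [Q']; monotonicity keeps [Q] true through the second extension. *)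
Lemma attainable_and (Q Q' : tree -> Prop) :
  monotone Q -> attainable Q -> attainable Q' ->
  attainable (fun t => Q t /\ Q' t).
Proof.
move=> mQ aQ aQ' t /aQ[t1 [/aQ'[t2 [r2 e12 q2]] [e1a e1m] q1]].
exists t2; split=> //; last by split=> //; apply: mQ q1.
by case: e12 => ea em; split=> s ?; [apply/ea/e1a | apply/em/e1m].
Qed.

Lemma attainableT (Q : tree -> Prop) : (forall t, Q t) -> attainable Q.
Proof. by move=> qT t tr; exists t; split=> //; split. Qed.

(** The modal successors of [c] become modal successors of the root; they force the bodies of the
    boxes in [G] because [c] forces [G]. *)
Lemma attainable_above (c : tree) (Q : tree -> Prop) :
  forces c G -> (forall t, Q (Child false c t)) -> attainable Q.
Proof.
move=> cG q t [tv ta tm]; exists (Child false c t); split=> //; split=> //=.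
- move=> s [->|cs|/ta] //; apply: forces_le cG; by right.
- move=> s [[]|cs|/tm] // A; rewrite mem_unboxed => /cG; exact.
- by move=> s ts; constructor 3.
- by move=> s ts; constructor 3.
Qed.

Lemma attainable_modal (c : tree) (Q : tree -> Prop) :
  forces c (G `+` unboxed G) -> (forall t, Q (Child true c t)) -> attainable Q.
Proof.
move=> cGG q; have cG : forces c G by move=> A AG; apply: cGG; rewrite in_msetD AG.
have cU : forces c (unboxed G) by move=> A AG; apply: cGG; rewrite in_msetD AG orbT.
move=> t [tv ta tm]; exists (Child true c t); split=> //; split=> //=.
- move=> s [->|cs|/ta] //; apply: forces_le cG; by right.
- move=> s [[_ [->//|cs]]|cs|/tm] //; first by apply: forces_le cU; right.
  by move=> A; rewrite mem_unboxed => /cG; exact.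
- by move=> s ts; constructor 3.
- by move=> s ts; constructor 3.
Qed.

Definition refutes_above (A : form) (t : tree) : Prop :=
  exists2 s, above t s & ~ force s A.

Definition refutes_modal (A : form) (t : tree) : Prop :=
  exists2 s, modal t s & ~ force s A.

Lemma monotone_above (A : form) : monotone (refutes_above A).
Proof. by move=> t t' [e _] [s ts sA]; exists s => //; apply: e. Qed.

Lemma monotone_modal (A : form) : monotone (refutes_modal A).
Proof. by move=> t t' [_ e] [s ts sA]; exists s => //; apply: e. Qed.

(** What a partial root still needs in order to force [F]. [False] marks the shapes whose rule
    settles the sequent, [True] those forced at every partial root. *)
Definition left_ok (F : form) (t : tree) : Prop :=
  match F with
  | Atom _ | Box _ | Imp Bot _ => True
  | Imp (Atom p) _ => Atom p \notin G
  | Imp (Imp A B) _ => refutes_above (Imp A B) t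
  | Imp (Box A) _ => refutes_modal A t
  | _ => False
  end.

Definition right_ok (t : tree) : Prop :=
  match D with
  | None | Some Bot => True
  | Some (Atom p) => Atom p \notin G
  | Some (Or A B) => refutes_above A t /\ refutes_above B t
  | Some (Box A) => refutes_modal A t
  | _ => False
  end.

Lemma monotone_left (F : form) : monotone (left_ok F).
Proof.
case: F => [|p|A B|A B|[|p|A B|A B|A B|A] C|A] t t' e //.
  exact: monotone_above.
exact: monotone_modal.
Qed.

Lemma attainable_all (s : seq form) :
  (forall F, F \in s -> decided G D \/ attainable (left_ok F)) ->
  decided G D \/ attainable (fun t => forall F, F \in s -> left_ok F t).
Proof.
elim: s => [|A s IH] h; first by right; apply: attainableT.
have [|aA] := h A (mem_head _ _); first by left.
have [F Fs||as_] := IH; [by apply: h; rewrite inE Fs orbT|by left|right].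
move=> t /(attainable_and (monotone_left (F := A)) aA as_)[t' [r e [qA qs]]].
by exists t'; split=> // F; rewrite inE => /orP[/eqP ->|/qs].
Qed.

(** A truth lemma limited to [G] and [D]: above the root [G] is already forced, and at the root no
    implication in [G] has a forced antecedent. *)
Lemma partial_root_countermodel (t : tree) :
  partial_root t -> (forall F, F \in G -> left_ok F t) -> right_ok t ->
  countermodel t G D.
Proof.
move=> [tv ta tm] tl tr; split.
  move=> F FG; move: (tl F FG); case: F FG => //=.
  - by move=> p pG _ s [->|/ta sG]; [rewrite tv | apply: (sG _ pG); left].
  - move=> A B FG q s [->|ts]; last by move: (ta _ ts _ FG); apply; left.
    case: A FG q => //=.
    + by move=> p FG pG /(_ t (or_introl erefl)); rewrite tv (negPf pG).
    + by move=> A1 A2 FG [u tu uA] tA; case: uA => w uw; apply: tA; right;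
        case: uw => [->|uw] //; apply: above_trans uw.
    + by move=> A1 FG [u tu uA] tA; case: uA; apply: tA.
  - by move=> A FG _ s ts; apply: (tm _ ts); rewrite mem_unboxed.
move: tr; rewrite /right_ok; case: D => [[|p|A B|A B|A B|A]|] //=; try by move=> _ [].
- by move=> pG /(_ t (or_introl erefl)); rewrite tv (negPf pG).
- by move=> [[s ts sA] [u tu uB]] [tA|tB];
    [apply: sA; apply: force_le tA | apply: uB; apply: force_le tB]; right.
- by move=> [s ts sA] tA; apply: sA; apply: tA.
Qed.

Lemma countermodel_left (t : tree) (F : form) (s : seq form) :
  F \in G -> ((forall A, A \in s -> force t A) -> force t F) ->
  countermodel t (add_seq (G `\ F) s) D -> countermodel t G D.
Proof.
move=> FG sF [tG tD]; split=> //; rewrite -(msetD_remove FG) forces_add.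
split=> [A AG|]; first by apply: tG; rewrite mem_add_seq AG.
by apply: sF => A As; apply: tG; rewrite mem_add_seq As orbT.
Qed.

(** * Analysis of a sequent by the shape of its formulas *)

(** One sequent serves both modal rules: with [□ A → B] kept in [G], the left premise of [ImpSL]
    equals the premise of [R4SL]. *)
Lemma decided_unboxed (A : form) :
  A \in U -> {subset box_bodies A <= U} ->
  G `+` unboxed G,, □ A ⇒ Some A \/ attainable (refutes_modal A).
Proof.
move=> AU bAU; have [AG|nAG] := boolP (Box A \in G).
  by left; apply: identity; rewrite !in_msetD mem_unboxed AG orbT.
have [|d|[t [tG tA]]] := decided_lower (S := (G `+` unboxed G,, □ A, Some A)).
- exact: lower_unboxed.
- by left.
right; apply: (attainable_modal (c := t)) => [B BG|t'].
  by apply: tG; rewrite in_msetD BG.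
by exists t => //=; constructor 1; split=> //; left.
Qed.

Lemma decided_left_or_ok (F : form) :
  F \in G -> decided G D \/ attainable (left_ok F).
Proof.
move=> FG; have EG := msetD_remove FG.
case: F FG EG => [|p|A B|A B|A C|A] FG EG.
- by left; left; rewrite -EG; apply: LBot.
- by right; apply: attainableT.
- left; apply: (decided_map (decided_left2 (A := A) (B := B) FG _ _ _ _ _)) => //=.
  + by move=> E; rewrite mem_cat => ->.
  + by move=> E; rewrite mem_cat => ->; rewrite orbT.
  + lia.
  + lia.
  + by rewrite -{2}EG; apply: LAnd.
  + move=> t; apply: (countermodel_left (s := [:: A; B])) => // h.
    by split; apply: h; rewrite !inE eqxx ?orbT.
- left; apply: (decided_map2 (decided_left1 (A := A) FG _ _ _)
                             (decided_left1 (A := B) FG _ _ _)) => //=.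
  + by move=> E; rewrite mem_cat => ->.
  + lia.
  + by move=> E; rewrite mem_cat => ->; rewrite orbT.
  + lia.
  + by rewrite -{3}EG; apply: LOr.
  + move=> t; apply: (countermodel_left (s := [:: A])) => // h.
    by left; apply: h; rewrite inE.
  + move=> t; apply: (countermodel_left (s := [:: B])) => // h.
    by right; apply: h; rewrite inE.
- have dC : decided (G `\ Imp A C,, C) D.
    apply: decided_left1 => //=; last lia.
    by move=> E; rewrite mem_cat => ->; rewrite orbT.
  (* [C] forces [A → C], so countermodels of the premise with [C] always transfer. *)
  have cC t : countermodel t (G `\ Imp A C,, C) D -> countermodel t G D.
    apply: (countermodel_left (s := [:: C])) => // h s ts _.
    by apply: force_le ts _; apply: h; rewrite inE.
  case: A FG EG dC cC => [|p|A B|A B|A B|A] FG EG dC cC.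
  + by right; apply: attainableT.
  + have [pG|npG] := boolP (Atom p \in G); last by right; apply: attainableT.
    left; apply: (decided_map dC) => // d.
    have pG' : Atom p \in G `\ Imp (Atom p) C.
      by rewrite in_msetB1 pG andbT; apply/implyP => /eqP.
    move: d; rewrite -{2}EG -(msetD_remove pG').
    exact: LAtomImp.
  + left; apply: (decided_map (decided_left1 (A := Imp A (Imp B C)) FG _ _ _)) => //=.
    * by move=> E; rewrite !mem_cat -!orbA.
    * lia.
    * by rewrite -{2}EG; apply: LAndImp.
    * move=> t; apply: (countermodel_left (s := [:: Imp A (Imp B C)])) => //.
      move=> /(_ _ (mem_head _ _)) h s ts [sA sB].
      by apply: (h s ts sA) => //; left.
  + left; apply: (decided_map
      (decided_left2 (A := Imp A C) (B := Imp B C) FG _ _ _ _ _)) => //=.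
    * by move=> E; rewrite !mem_cat => /orP[]->; rewrite ?orbT.
    * by move=> E; rewrite !mem_cat => /orP[]->; rewrite ?orbT.
    * lia.
    * lia.
    * by rewrite -{2}EG; apply: LOrImp.
    * move=> t; apply: (countermodel_left (s := [:: Imp A C; Imp B C])) => // h s ts.
      by case=> [sA|sB]; [apply: (h (Imp A C)) sA | apply: (h (Imp B C)) sB];
        rewrite ?inE ?eqxx ?orbT.
  + have : decided (G `\ Imp (Imp A B) C,, (B → C),, A) (Some B).
      apply: (decided_left (s := [:: Imp B C; A])) => //=.
        move=> E [|[<-]] => [|X XB]; last by rewrite !mem_cat XB orbT.
        by rewrite !inE => /orP[] /eqP -> X /=; rewrite !mem_cat;
          [case/orP|] => ->; rewrite ?orbT.
      (* The weight of [D] is discarded: the three new formulas together already weigh less than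
         [F]. *)
      apply: ltn_addr; have -> : weight_seq [:: Imp B C; A] + weight_seq [:: B]
                              = weight_seq [:: Imp B C; A; B].
        by rewrite /weight_seq -big_cat.
      by apply: weight_lt => // E; rewrite !inE => /or3P[] /eqP -> /=; lia.
    case=> [d|[t [tG tB]]]; [left; apply: (decided_map dC)|right].
      by rewrite -{2}EG; apply: LImpImp.
      by [].
    move: tG; rewrite !forces_add => -[[tG tBC] tA].
    (* [t] forces [A] and [B → C], hence [(A → B) → C] and all of [G]; as it does not force [B], it
       refutes [A → B]. *)
    apply: (attainable_above (c := t)).
      rewrite -EG forces_add; split=> // s ts sAB.
      apply: (tBC s ts); apply: (sAB s); first by left.
      exact: force_le tA.
    move=> t'; exists t; first by constructor 1.
    by move=> h; apply: tB; apply: h => //; left.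
  + have [||d|] := decided_unboxed (A := A).
    * by apply: (inU (or_introl FG)); rewrite /= inE eqxx.
    * by move=> X XA; apply: (inU (or_introl FG)); rewrite /= inE mem_cat XA orbT.
    * left; apply: (decided_map dC) => // d'.
      rewrite -EG; apply: ImpSL_unboxed d'; move: d.
      (* Deleting an implication leaves [unboxed] unchanged, so both sides agree up to order. *)
      congr (G4iSL' _ _); apply/msetP => X.
      rewrite !msetE2 !unboxedE -{1 2}EG !msetE2.
      by rewrite [msetn 1 (_ → _)%form (Box X)]msetnE /=; lia.
    * by right.
- by right; apply: attainableT.
Qed.

Lemma decided_right_or_ok : decided G D \/ attainable right_ok.
Proof.
rewrite /right_ok.
(* [s] has at most two members, since [A'] takes one of the three places in [weight_lt]. *)
have low s A A' : D = Some A ->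
    (forall B, B \in A' :: s -> {subset box_bodies B <= box_bodies A}) ->
    (forall B, B \in A' :: s -> size_form B < size_form A) -> size s < 3 ->
    decided (add_seq G s) (Some A').
  move=> eD sA wA s3; apply: (decided_lower (S := (_, _))); rewrite eD.
  by apply: lower_right => //; [rewrite -eD | apply: weight_lt].
case eD: D => [[|p|A B|A B|A B|A]|]; try by right; apply: attainableT.
- have [pG|pG] := boolP (Atom p \in G); last by right; apply: attainableT.
  by left; left; apply: identity.
- left; have dA : decided G (Some A).
    apply: (low [::] _ _ eD) => // E; rewrite inE => /eqP -> /=; last lia.
    by move=> X XA; rewrite mem_cat XA.
  have dB : decided G (Some B).
    apply: (low [::] _ _ eD) => // E; rewrite inE => /eqP -> /=; last lia.
    by move=> X XA; rewrite mem_cat XA orbT.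
  apply: (decided_map2 dA dB); first exact: RAnd.
    by move=> t [tG tA]; split=> // -[].
  by move=> t [tG tA]; split=> // -[].
- have dA : decided G (Some A).
    apply: (low [::] _ _ eD) => // E; rewrite inE => /eqP -> /=; last lia.
    by move=> X XA; rewrite mem_cat XA.
  have dB : decided G (Some B).
    apply: (low [::] _ _ eD) => // E; rewrite inE => /eqP -> /=; last lia.
    by move=> X XA; rewrite mem_cat XA orbT.
  case: dA => [d|[t [tG tA]]]; first by left; left; apply: ROr1.
  case: dB => [d|[u [uG uB]]]; first by left; left; apply: ROr2.
  right; apply: attainable_and; first exact: monotone_above.
    by apply: (attainable_above tG) => t'; exists t => //; constructor 1.
  by apply: (attainable_above uG) => t'; exists u => //; constructor 1.
- left; have dB : decided (G,, A) (Some B).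
    apply: (low [:: A] _ _ eD) => // E; rewrite !inE => /orP[] /eqP -> /=; try lia.
      by move=> X XA; rewrite mem_cat XA orbT.
    by move=> X XA; rewrite mem_cat XA.
  apply: (decided_map dB); first exact: RImp.
  move=> t [/forces_add[tG tA] tB]; split=> // tAB; apply: tB.
  by apply: (tAB t) => //; left.
- have [||d|] := decided_unboxed (A := A); last by right.
  + by apply: (inU (or_intror eD)); rewrite /= inE eqxx.
  + by move=> X XA; apply: (inU (or_intror eD)); rewrite /= inE XA orbT.
  + by left; left; apply: R4SL_unboxed.
Qed.

Lemma decided_step : decided G D.
Proof.
have [||aG] := attainable_all (s := G); [exact: decided_left_or_ok|by []|].
have [//|aD] := decided_right_or_ok.
have mG : monotone (fun t => forall F, F \in enum_mset G -> left_ok F t).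
  by move=> t t' e h F /h; apply: monotone_left.
have r0 : partial_root (Root (fun p => Atom p \in G)) by split.
have [t [r _ [tG tD]]] := attainable_and mG aG aD r0.
by right; exists t; apply: partial_root_countermodel.
Qed.

End Step.

(** * Termination of the search and completeness *)

Lemma decided_within (n m : nat) (G : {mset form}) (D : option form) :
  within G D -> missing G < n -> weight_sequent G D < m -> decided G D.
Proof.
elim: n m G D => // n IHn; elim=> // m IHm G D inU Gn Gm.
apply: decided_step => // -[G' D'] [/= inU' [Gl|[Ge wl]]].
  (* The weight bound is chosen afresh, because the weight may have grown. *)
  by apply: (IHn (weight_sequent G' D').+1) => //; lia.
by apply: IHm => //; lia.
Qed.

End Completeness.

Theorem completeness (G : {mset form}) (D : option form) :
  (forall t, forces t G -> force_opt t D) -> G ⇒ D.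
Proof.
set U := flatten [seq box_bodies A | A <- G] ++ oapp box_bodies [::] D.
have inU : within U G D.
  move=> A [AG|DA] B BA; rewrite mem_cat; last by rewrite DA BA orbT.
  by apply/orP; left; apply/flattenP; exists (box_bodies A) => //; apply: map_f.
have [//|[t [tG tD]] /(_ t tG)] := decided_within inU (ltnSn _) (ltnSn _).
exact.
Qed.

(** * Contraction and cut *)

Theorem corollary4 :
  (forall (G : {mset form}) (A : form) (D : option form),
      G,, A,, A ⇒ D -> G,, A ⇒ D) /\
  (forall (G1 G2 : {mset form}) (A : form) (D : option form),
      G1 ⇒ Some A -> G2,, A ⇒ D -> G1 `+` G2 ⇒ D).
Proof.
split=> [G A D /soundness h|G1 G2 A D /soundness h1 /soundness h2].
  (* Forcing reads an antecedent as a set, so one copy of [A] yields both. *)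
  apply: completeness => t tGA; apply: h; rewrite forces_add; split=> //.
  by case/forces_add: tGA.
(* A point forcing both contexts forces [A] by the first sequent, hence the whole antecedent of the
   second. *)
apply: completeness => t tG; apply: h2; rewrite forces_add; split=> [B BG|].
  by apply: tG; rewrite in_msetD BG orbT.
by apply: h1 => B BG; apply: tG; rewrite in_msetD BG.
Qed.
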